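(* For a Tychonoff space $X$ and an ordinal $0<\alpha\leq\omega_1$, the following statements are equivalent: (1) $B_\alpha(X)$ is strongly sequentially separable; (2) $iw(X)=\aleph_0$ and $X$ satisfies $S_1(Z^\alpha_\Omega,Z^\alpha_\Gamma)$; (3) $iw(X)=\aleph_0$ and $X$ is a $Z^\alpha$-cover $\gamma$-set.
   Context: $B_0(X)=C(X)$ is the set of continuous real-valued functions on $X$, and for each ordinal $0<\alpha\le\omega_1$, $B_\alpha(X)$ is the set of pointwise limits of sequences of functions in $\bigcup_{\xi<\alpha}B_\xi(X)$, with the topology of pointwise convergence. $Z_\xi(X)$ is the family of zero sets of bounded functions in $B_\xi(X)$, and $Z^\alpha=\left(\bigcup_{\xi<\alpha}Z_\xi(X)\right)_\delta$ is the family of countable intersections of members of $\bigcup_{\xi<\alpha}Z_\xi(X)$. A space $Z$ is strongly sequentially separable if it is separable and, for every countable dense $D\subseteq Z$, every point of $Z$ is the limit of a sequence of points of $D$. $iw(X)$ is the smallest infinite cardinal $\tau$ such that $X$ admits a one-to-one continuous map onto a Tychonoff space of weight at most $\tau$. A cover $\mathcal{U}$ of $X$ is an $\omega$-cover if $X\notin\mathcal{U}$ and every finite subset of $X$ is contained in a member of $\mathcal{U}$; it is a $\gamma$-cover if it is infinite and each $x\in X$ belongs to all but finitely many elements of $\mathcal{U}$. $Z^\alpha_\Omega$ (resp. $Z^\alpha_\Gamma$) is the family of countable $\omega$-covers (resp. countable $\gamma$-covers) of $X$ consisting of sets in $Z^\alpha$. $S_1(\mathcal{A},\mathcal{B})$: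 for each sequence $(A_n:n\in\omega)$ of elements of $\mathcal{A}$ there are $b_n\in A_n$ such that $\{b_n:n\in\omega\}\in\mathcal{B}$. $X$ is a $Z^\alpha$-cover $\gamma$-set if every countable $\omega$-cover of $X$ by sets in $Z^\alpha$ contains a $\gamma$-cover of $X$. *)

(* Defs.v *)
From HB Require Import structures.
From mathcomp Require Import all_boot all_order all_algebra.
From mathcomp Require Import all_classical all_reals all_analysis.
From mathcomp Require Import wochoice.

Set Implicit Arguments.
Unset Strict Implicit.
Unset Printing Implicit Defensive.

Import Order.TTheory GRing.Theory Num.Theory.
Import numFieldNormedType.Exports.

Local Open Scope classical_set_scope.
Local Open Scope ring_scope.

(* Ordinals are represented as points of a well-ordered type [W]: the point
   [a] stands for the order type of [[set b | b < a]].  Hence 0 is the least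
   element of [W], and omega_1 is the least point with uncountably many
   predecessors. *)
Section Ordinals.
Context (d : Order.disp_t) (W : orderType d).

Definition well_ordered := well_order (<=%O : rel W).

Definition is_ord0 (a : W) := forall b : W, (a <= b)%O.

Definition is_omega1 (w : W) :=
  ~ countable [set b : W | (b < w)%O] /\
  forall a : W, (a < w)%O -> countable [set b : W | (b < a)%O].

End Ordinals.

Section Topology.

Definition tychonoff_space (T : topologicalType) :=
  completely_regular_space T /\ hausdorff_space T.

Definition separable (T : topologicalType) :=
  exists D : set T, countable D /\ dense D.

Definition strongly_sequentially_separable (T : topologicalType) :=
  separable T /\
  forall D : set T, countable D -> dense D ->
  forall z : T, exists u : nat -> T, (forall n, D (u n)) /\ u @ \oo --> z.

(* Cardinals are represented by types. *)
Definition weight_le (T : topologicalType) (K : Type) :=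
  exists2 B : set (set T), (B #<= [set: K])%card & basis B.

Definition condenses_to_weight_le (T : topologicalType) (K : Type) :=
  exists (Y : topologicalType) (f : T -> Y),
    [/\ tychonoff_space Y, weight_le Y K, continuous f,
        injective f & range f = [set: Y]].

Definition iw_is (T : topologicalType) (K : Type) :=
  [/\ infinite_set [set: K], condenses_to_weight_le T K &
      forall K' : Type, infinite_set [set: K'] ->
        condenses_to_weight_le T K' -> ([set: K] #<= [set: K'])%card].

End Topology.

Section Baire.
Context (R : realType) (X : topologicalType).
Context (d : Order.disp_t) (W : orderType d).

(* [baire a] is the set B_a(X). *)
Inductive baire (a : W) : set (X -> R) :=
| baire_continuous f : is_ord0 a -> continuous f -> baire a f
| baire_limit f (u : nat -> X -> R) : ~ is_ord0 a ->
    (forall n, exists2 b : W, (b < a)%O & baire b (u n)) ->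
    (forall x, u ^~ x @ \oo --> f x) ->
    baire a f.

(* B_a(X) as a subspace of R^X with the topology of pointwise convergence. *)
Definition baire_space (a : W) : topologicalType :=
  set_type (baire a : set {ptws X -> R}).

Definition baire_zero (a : W) : set (set X) :=
  [set Z | exists f : X -> R, [/\ baire a f,
    exists M : R, forall x, `|f x| <= M & Z = f @^-1` [set 0]]].

(* the family Z^a *)
Definition Zset (a : W) : set (set X) :=
  [set A | exists F : nat -> set X,
    (forall n, exists2 b : W, (b < a)%O & baire_zero b (F n)) /\
    A = \bigcap_n F n].

End Baire.

Arguments baire_space R X {d W} a.
Arguments Zset R X {d W} a.

Section Covers.
Context (X : Type).
Implicit Types (U V : set (set X)) (Z : set (set X)).

Definition is_cover U := \bigcup_(A in U) A = [set: X].

Definition omega_cover U :=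
  [/\ is_cover U, ~ U [set: X] &
      forall F : set X, finite_set F -> exists2 A, U A & F `<=` A].

Definition gamma_cover U :=
  [/\ is_cover U, infinite_set U &
      forall x, finite_set [set A | U A /\ ~ A x]].

Definition countable_omega_covers Z : set (set (set X)) :=
  [set U | [/\ countable U, U `<=` Z & omega_cover U]].

Definition countable_gamma_covers Z : set (set (set X)) :=
  [set U | [/\ countable U, U `<=` Z & gamma_cover U]].

Definition cover_gamma_set Z :=
  forall U, countable_omega_covers Z U ->
  exists2 V, V `<=` U & gamma_cover V.

End Covers.

(* the selection principle S_1(A, B) *)
Definition S1 (T : Type) (A B : set (set T)) :=
  forall U : nat -> set T, (forall n, A (U n)) ->
  exists b : nat -> T, (forall n, U n (b n)) /\ B (range b).

(* Main.v *)
Require Import Defs.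
From HB Require Import structures.
From mathcomp Require Import all_boot all_order all_algebra.
From mathcomp Require Import all_classical all_reals all_analysis.
From mathcomp Require Import wochoice lra.

(** Strong sequential separability gives the gamma-property, which gives the
    selection principle, which gives back strong sequential separability. Baire
    functions enter this cycle through two facts: the indicator of a set of
    [Z^a] belongs to [B_a] ([baire_indic]), and conversely the set where a
    function of [B_a] is small is exhausted by sets of [Z^a]
    ([baire_sublevel]).

    Separability to covers. A countable dense subset of [B_a] separates points
    and each of its members depends on countably many continuous functions
    ([baire_depends_countable]); the topology which these generate shows that
    [iw X] is countable. Given a countable omega-cover by sets of [Z^a],
    replace the values of the functions of the dense set by 1 off a member of
    the cover, in all possible ways. The result is still dense, and a sequence
    of such functions that tends to 0 picks out a gamma-cover.

    Subcovers to selections. The passage from subcovers to the selection of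
    one set in each cover of a sequence refines the covers by their
    predecessors and intersects them with a sequence of proper sets of [Z^a]
    almost all of which contain any given point ([S1_of_cover_gamma_set]). An
    infinite Tychonoff space has such a sequence: the complements of pairwise
    disjoint nonempty cozero sets ([disjoint_cozero]). Finite spaces have no
    omega-cover.

    Covers to separability. A coarser topology of countable weight provides
    countably many continuous functions which take the values 0 and 1 at any
    two given distinct points in either order; the rational algebra which they
    generate is dense ([rat_comb_dense]), whence separability. For a countable
    dense family [e] and a target [z], the sets of [Z^a] on which some [|e t -
    z|] is at most [1/(n+1)] form, for each [n], an omega-cover unless one of
    them is the whole space; selecting one set for each [n] yields a sequence
    tending to [z]. *)

Set Implicit Arguments.
Unset Strict Implicit.
Unset Printing Implicit Defensive.

Import Order.TTheory GRing.Theory Num.Theory.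
Import numFieldNormedType.Exports.

Local Open Scope classical_set_scope.
Local Open Scope ring_scope.

(** * Countable sets and well-ordered induction *)

Lemma countable_enum (T : Type) (A : set T) (x0 : T) : countable A ->
  exists f : nat -> T, A `<=` range f /\ forall n, A (f n) \/ f n = x0.
Proof.
move=> /pfcard_geP[->|[f]].
  by exists (fun=> x0); split=> // n; right.
exists f; split=> [|n].
  by move=> x Ax; have [n _ <-] := @surj _ _ _ _ f _ Ax; exists n.
by left; exact: funS.
Qed.

Lemma natS_inv_lt (R : realType) (e : R) : 0 < e ->
  \forall n \near \oo, n.+1%:R^-1 < e.
Proof. by move=> e0; exact: (near_infty_natSinv_lt (PosNum e0)). Qed.

Section WellOrder.
Context (d : Order.disp_t) (W : orderType d) (W_wo : well_ordered W).

Lemma wo_ind (P : W -> Prop) :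
  (forall a, (forall b, (b < a)%O -> P b) -> P a) -> forall a, P a.
Proof.
move=> IH a; apply: contrapT => nPa.
have neA : wochoice.nonempty [pred x | `[< ~ P x >]].
  by exists a; apply/asboolP.
have [m [[mA mmin] _]] := W_wo neA.
move: mA => /asboolP; apply; apply: IH => b ltbm.
apply: contrapT => nPb; have /mmin : b \in [pred x | `[< ~ P x >]].
  exact/asboolP.
by rewrite /= leNgt ltbm.
Qed.

Lemma not_is_ord0P (a : W) : ~ is_ord0 a <-> exists b, (b < a)%O.
Proof.
split=> [/existsNP[b /negP]|[b ltba] /(_ b)]; last by rewrite leNgt ltba.
by rewrite -ltNge; exists b.
Qed.

End WellOrder.

(** * Closure properties of the Baire classes *)

Section BaireClosure.
Context (R : realType) (X : topologicalType).
Context (d : Order.disp_t) (W : orderType d) (W_wo : well_ordered W).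
Implicit Types (a b : W) (f g : X -> R).

Lemma baire_lt a b f : (a < b)%O -> baire a f -> baire b f.
Proof.
move=> ltab af; apply: (@baire_limit _ _ _ _ b f (fun=> f)).
- by apply/not_is_ord0P; exists a.
- by move=> n; exists a.
- by move=> x; exact: cvg_cst.
Qed.

Lemma baire_le a b f : (a <= b)%O -> baire a f -> baire b f.
Proof. by rewrite le_eqVlt => /predU1P[->//|]; exact: baire_lt. Qed.

Lemma baire_common a b b' f g : (b < a)%O -> (b' < a)%O ->
  baire b f -> baire b' g -> exists c, [/\ (c < a)%O, baire c f & baire c g].
Proof.
move=> ba b'a bf bg; exists (Order.max b b'); split.
- by rewrite gt_max ba b'a.
- by apply: baire_le bf; rewrite le_max lexx.
- by apply: baire_le bg; rewrite le_max lexx orbT.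
Qed.

(** Continuous functions are put in class 0 only; constant sequences carry them
    to the higher classes, where induction is needed to reach class 0. *)
Lemma baire_of_continuous a f : continuous f -> baire a f.
Proof.
move=> cf; elim/(wo_ind W_wo): a => a IH.
have [a0|/not_is_ord0P[b ba]] := pselect (is_ord0 a).
  exact: baire_continuous.
exact/(baire_lt ba)/IH.
Qed.

Lemma baire_seq a f : ~ is_ord0 a -> baire a f ->
  exists u : nat -> X -> R, (forall n, exists2 b, (b < a)%O & baire b (u n)) /\
    forall x, u ^~ x @ \oo --> f x.
Proof. by move=> a0; case=> [//|{}f u _ uB ucvg]; exists u. Qed.

(** Induction on the class: by [baire_common] the two approximating sequences
    can be combined termwise inside a smaller class, and a continuous operation
    passes to the limit. All the algebraic closure properties below are
    instances. *)
Lemma baire_comp2 (h : R -> R -> R) a f g :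
  continuous (fun z : R * R => h z.1 z.2) ->
  baire a f -> baire a g -> baire a (fun x => h (f x) (g x)).
Proof.
move=> ch; elim/(wo_ind W_wo): a f g => a IH f g.
have [a0|a0] := pselect (is_ord0 a).
  case=> [{}f _ cf|//]; case=> [{}g _ cg|//].
  apply: baire_continuous => // x.
  exact: (continuous2_cvg _ (ch (f x, g x)) (cf x) (cg x)).
move=> /(baire_seq a0)[u [uB ucvg]] /(baire_seq a0)[v [vB vcvg]].
apply: (@baire_limit _ _ _ _ a _ (fun n x => h (u n x) (v n x))) => // [n|x].
  have [[b ba bu] [b' b'a bv]] := (uB n, vB n).
  have [c [ca cu cv]] := baire_common ba b'a bu bv.
  by exists c => //; apply: IH.
exact: (continuous2_cvg _ (ch (f x, g x)) (ucvg x) (vcvg x)).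
Qed.

Lemma baire_comp (h : R -> R) a f : continuous h ->
  baire a f -> baire a (h \o f).
Proof.
move=> ch bf; apply: (@baire_comp2 (fun y _ => h y) a f f) => // z.
by apply: continuous_comp (ch _); exact: cvg_fst.
Qed.

Lemma baireD a f g : baire a f -> baire a g -> baire a (fun x => f x + g x).
Proof. by apply: (@baire_comp2 +%R) => z; exact: add_continuous. Qed.

Lemma baireM a f g : baire a f -> baire a g -> baire a (fun x => f x * g x).
Proof. by apply: (@baire_comp2 *%R) => z; exact: mul_continuous. Qed.

Lemma baireN a f : baire a f -> baire a (fun x => - f x).
Proof. by apply: (@baire_comp (fun y => - y)) => z; exact: opp_continuous. Qed.

Lemma baireB a f g : baire a f -> baire a g -> baire a (fun x => f x - g x).
Proof. by move=> bf /baireN; exact: baireD. Qed.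

Lemma baire_norm a f : baire a f -> baire a (fun x => `|f x|).
Proof.
by apply: (@baire_comp (fun y => `|y|)) => z; exact: norm_continuous.
Qed.

Lemma baire_cst a (c : R) : baire a (fun _ : X => c).
Proof. by apply: baire_of_continuous => x; exact: cvg_cst. Qed.

End BaireClosure.

(** * Truncation to the unit interval *)

Section Clamp.
Context (R : realType).

(** Composition with this map makes a function bounded while its zero set
    becomes the set where the function was nonpositive ([clamp_eq0]); this is
    how sublevel sets are seen to be zero sets of bounded functions. *)
Definition clamp (t : R) : R := Num.min 1 (Num.max 0 t).

Lemma clamp_continuous : continuous clamp.
Proof.
move=> t.
have cm : {for t, continuous ((fun=> 0 : R^o) \max (id : R -> R^o))}.
  by apply: continuous_max; [exact: cvg_cst|exact: cvg_id].
exact: (@continuous_min R R (fun=> 1) _ t (@cvg_cst _ _ _ _ _) cm).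
Qed.

Lemma clamp_ge0 t : 0 <= clamp t.
Proof. by rewrite /clamp le_min ler01 le_max lexx. Qed.

Lemma clamp_le1 t : clamp t <= 1.
Proof. by rewrite /clamp ge_min lexx. Qed.

Lemma clamp_le0 t : t <= 0 -> clamp t = 0.
Proof. by move=> t0; rewrite /clamp max_l// min_r. Qed.

Lemma clamp_ge1 t : 1 <= t -> clamp t = 1.
Proof. by move=> t1; rewrite /clamp max_r ?min_l//; lra. Qed.

Lemma clamp_eq0 t : (clamp t = 0) <-> (t <= 0).
Proof.
split; last exact: clamp_le0.
move=> t0; rewrite leNgt; apply/negP => t_gt0; move: t0; apply/eqP.
by rewrite gt_eqF// lt_min ltr01 lt_max t_gt0 orbT.
Qed.

End Clamp.

(** * The family [Z^a] and its link with [B_a] *)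

Section ZsetClosure.
Context (R : realType) (X : topologicalType).
Context (d : Order.disp_t) (W : orderType d) (W_wo : well_ordered W).
Implicit Types (a b : W) (f g : X -> R) (A B : set X).

Lemma Zset_le a b f (c : R) : (b < a)%O -> baire b f ->
  Zset R X a [set x | f x <= c].
Proof.
move=> ba bf; exists (fun=> [set x | f x <= c]); split; last first.
  by rewrite bigcap_const//; exists 0%N.
move=> _; exists b => //; exists (fun x => clamp (f x - c)); split.
- apply: (baire_comp W_wo (@clamp_continuous R)).
  by apply: baireB => //; exact: baire_cst.
- by exists 1 => x; rewrite ger0_norm ?clamp_ge0 ?clamp_le1.
- by apply/seteqP; split=> x /=; rewrite clamp_eq0 subr_le0.
Qed.

Lemma Zset_bigcap a (F : nat -> set X) :
  (forall n, Zset R X a (F n)) -> Zset R X a (\bigcap_n F n).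
Proof.
move=> /choice[G GP].
(* Codes that represent no pair repeat a set already present, which leaves
   the intersection unchanged. *)
pose H k := if choice.unpickle k is Some nm then G nm.1 nm.2 else G 0%N 0%N.
exists H; split=> [k|].
  by rewrite /H; case: choice.unpickle => [nm|]; exact: (GP _).1.
apply/seteqP; split=> x Fx k _.
- rewrite /H; case: choice.unpickle => [[n m]|] /=.
    by have := Fx n I; rewrite (GP n).2; apply.
  by have := Fx 0%N I; rewrite (GP 0%N).2; apply.
- by rewrite (GP k).2 => m _; have := Fx (choice.pickle (k, m)) I;
    rewrite /H choice.pickleK.
Qed.

Lemma baire_partial_sum a (f : nat -> X -> R) (n : nat) :
  (forall i, exists2 b, (b < a)%O & baire b (f i)) ->
  exists2 b, (b < a)%O & baire b (fun x => \sum_(i < n.+1) `|f i x|).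
Proof.
move=> fB; elim: n => [|n [b ba bS]].
  have [b ba bf] := fB 0%N; exists b => //.
  under eq_fun do rewrite big_ord1.
  exact: baire_norm.
have [b' b'a bf] := fB n.+1.
have [c [ca cS cf]] := baire_common ba b'a bS bf.
exists c => //; under eq_fun do rewrite big_ord_recr/=.
by apply: baireD => //; exact: baire_norm.
Qed.

(** If [A] is the intersection of the zero sets of [f_0, f_1, ...], then the
    sums [S_n = |f_0| + ... + |f_n|] vanish on [A] and are eventually bounded
    away from 0 at each point outside [A], so that [clamp (1 - n * S_n)] tends
    to the indicator of [A]. The terms of this sequence belong to classes below
    [a] because finitely many such classes have a maximum: one limit on top of
    the classes that define [Z^a] is exactly what [B_a] allows. *)
Lemma baire_indic a A : ~ is_ord0 a -> Zset R X a A ->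
  baire a (\1_A : X -> R).
Proof.
move=> a0 [F [zF ->]].
have /choice[f fP] : forall n, exists f : X -> R,
    (exists2 b, (b < a)%O & baire b f) /\ F n = f @^-1` [set 0].
  move=> n; have [b ba [f [bf _ ->]]] := zF n.
  by exists f; split=> //; exists b.
pose S n x : R := \sum_(i < n.+1) `|f i x|.
apply: (@baire_limit _ _ _ _ a _ (fun n x => clamp (1 - n%:R * S n x))) => //.
  move=> n; have [b ba bS] := baire_partial_sum n (fun i => (fP i).1).
  exists b => //; apply: (baire_comp W_wo (@clamp_continuous R)).
  apply: baireB => //; first exact: baire_cst.
  by apply: baireM => //; exact: baire_cst.
move=> x; rewrite indicE; have [Ax|nAx] := boolP (x \in _).
  rewrite (_ : (fun n => _) = fun=> 1); first exact: cvg_cst.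
  apply/funext => n; rewrite /S big1 ?mulr0 ?subr0 ?clamp_ge1//.
  move=> i _; move: Ax; rewrite inE => /(_ i I); rewrite (fP i).2 /= => ->.
  by rewrite normr0.
have [i] : exists i, ~ F i x.
  apply: contrapT => /forallNP Fx; move: nAx; rewrite notin_setE => nAx.
  apply: nAx => i _.
  exact: contrapT (Fx i).
rewrite (fP i).2 /= => /eqP fi0.
have fi_gt0 : 0 < `|f i x| by rewrite normr_gt0.
have ige : \forall n \near \oo, (i <= n)%N by exact: nbhs_infty_ge.
have nge : \forall n \near \oo, `|f i x|^-1 <= n%:R :> R.
  exact: nbhs_infty_ger.
apply: cvg_near_cst.
near=> n; rewrite clamp_le0// subr_le0.
have lefiS : `|f i x| <= S n x.
  have lin : (i < n.+1)%N by rewrite ltnS; near: n.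
  by rewrite /S (bigD1 (Ordinal lin))//= lerDl sumr_ge0.
have /ler_wpM2r : `|f i x|^-1 <= n%:R by near: n.
move=> /(_ _ (normr_ge0 (f i x))); rewrite mulVf ?gt_eqF// => /le_trans; apply.
by apply: ler_wpM2l.
Unshelve. all: by end_near. Qed.

(** Modifying a function of [B_a] off a member of [Z^a] keeps it in [B_a]; this
    is how covers by sets of [Z^a] are turned into families of functions. *)
Lemma baire_glue a A f g : ~ is_ord0 a -> Zset R X a A ->
  baire a f -> baire a g ->
  baire a (fun x => if x \in A then f x else g x).
Proof.
move=> a0 zA bf bg.
rewrite (_ : (fun x => _) = fun x => g x + \1_A x * (f x - g x)).
  apply: baireD => //; apply: baireM => //; first exact: baire_indic.
  exact: baireB.
apply/funext => x; rewrite indicE.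
by case: ifP => _; rewrite ?mulr1n ?mulr0n; lra.
Qed.

End ZsetClosure.

(** * The space [B_a] in terms of families of functions *)

Lemma cvg_initial (S : choiceType) (T : topologicalType) (h : S -> T)
    (F : set_system S) (s : S) : Filter F ->
  F --> (s : initial_topology h) <-> h @ F --> h s.
Proof.
move=> FF; split=> [Fs|hF A [_ [[B oB <-] Bs] sBA]].
  apply: (cvg_trans _ (@initial_continuous _ _ h s)).
  exact: (@cvg_app _ _ F (nbhs (s : initial_topology h)) h).
by apply: (filterS sBA); apply: hF; exact: open_nbhs_nbhs.
Qed.

Section BaireSpace.
Context (R : realType) (X : topologicalType).
Context (d : Order.disp_t) (W : orderType d) (W_wo : well_ordered W).
Context (a : W).
Local Notation BX := (baire_space R X a).

Definition baire_val (w : BX) : X -> R := set_val w.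

Lemma baire_valP w : baire a (baire_val w).
Proof. exact: (set_valP w). Qed.

Definition baire_elt f (bf : baire a f) : BX := exist _ f (mem_set bf).

Lemma baire_eltK f (bf : baire a f) : baire_val (baire_elt bf) = f.
Proof. by []. Qed.

Lemma baire_space_cvgP (F : set_system BX) (z : BX) : Filter F ->
  F --> z <-> forall x, (fun w => baire_val w x) @ F --> baire_val z x.
Proof.
move=> FF; split=> [/cvg_initial Fz x|Fz].
  exact: ((pointwise_cvgP _ _).1 Fz x).
apply/cvg_initial.
apply/(@pointwise_cvgP X R (baire_val @ F) (baire_val z)).
by move=> x; exact: Fz.
Qed.

Lemma eval_continuous (x : X) : continuous (fun w : BX => baire_val w x).
Proof. by move=> z; have /baire_space_cvgP := @cvg_id _ (nbhs z); apply. Qed.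

(** Density for pointwise convergence, read on the basic neighbourhoods, which
    constrain finitely many values. *)
Definition family_dense (T : Type) (e : T -> X -> R) :=
  forall z, baire a z -> forall (s : seq X) (eps : R), 0 < eps ->
  exists t, forall x, x \in s -> `|e t x - z x| < eps.

Lemma family_denseP (T : Type) (e : T -> BX) :
  dense (range e) <-> family_dense (fun t => baire_val (e t)).
Proof.
split=> [De z bz s eps eps0|De O [z Oz] oO].
- pose B (x : X) := [set w : BX | `|baire_val w x - z x| < eps].
  have oB x : open (B x).
    have -> : B x =
      (fun w : BX => baire_val w x) @^-1` [set r | `|r - z x| < eps] by [].
    apply: open_comp => [w _|]; first exact: eval_continuous.
    rewrite (_ : [set r | _] = ball (z x) eps); first exact: ball_open.
    by apply/seteqP; split=> r /=; rewrite /ball/= distrC.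
  have oO : open (\bigcap_(x in [set` s]) B x).
    by rewrite bigcap_seq; elim/big_ind: _ => //; [exact: openT|exact: openI].
  have [|w [Bw [t _ tw]]] := De _ _ oO.
    by exists (baire_elt bz) => x _; rewrite /B/= baire_eltK subrr normr0.
  by exists t => x xs; rewrite tw; exact: Bw.
- (* The filter [F] generated by the basic neighbourhoods [D p] converges to
     [z], hence contains [O]; this produces a basic neighbourhood inside [O]
     from the characterization of convergence alone. *)
  pose D (p : seq X * R) :=
    [set w : BX |
      forall x, x \in p.1 -> `|baire_val w x - baire_val z x| < p.2].
  pose F := filter_from [set p : seq X * R | 0 < p.2] D.
  have FF : Filter F.
    apply: filter_from_filter; first by exists ([::], 1) => /=.
    move=> [s1 e1] [s2 e2]/= e10 e20; exists (s1 ++ s2, Num.min e1 e2) => /=.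
      by rewrite lt_min e10.
    move=> w Dw; split=> x /= xs; have := Dw x;
      rewrite /= mem_cat xs ?orbT => /(_ isT); by rewrite lt_min => /andP[].
  have /baire_space_cvgP Fz :
      forall x, (fun w => baire_val w x) @ F --> baire_val z x.
    move=> x; apply/cvgrPdist_lt => eps eps0; exists ([:: x], eps) => //= w.
    by move=> /(_ x); rewrite distrC; apply; rewrite mem_head.
  have [[s eps]/= eps0 sO] : F O by apply: Fz; exact: open_nbhs_nbhs.
  have [t te] := De _ (baire_valP z) s eps eps0.
  by exists (e t); split=> //; exact: sO.
Qed.

(** Replaces the points of the subspace [B_a] and its countable subsets by
    functions and families indexed by a countable type, so that the arguments
    below can index dense families by whatever data they are built from. *)
Lemma strongly_sequentially_separableP :
  strongly_sequentially_separable BX <->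
  (exists e : nat -> X -> R, (forall n, baire a (e n)) /\ family_dense e) /\
  forall (T : countType) (e : T -> X -> R), (forall t, baire a (e t)) ->
    family_dense e -> forall z, baire a z ->
    exists k : nat -> T, forall x, e (k n) x @[n --> \oo] --> z x.
Proof.
pose zero : BX := baire_elt (baire_cst X W_wo a (0 : R)).
have range_of (D : set BX) : countable D -> dense D ->
    exists e : nat -> BX, D = range e.
  move=> cD dD; have [w0 Dw0] : D !=set0.
    have [|w [_ Dw]] := dD setT _ openT; first by exists zero.
    by exists w.
  have [e [De eD]] := countable_enum w0 cD; exists e.
  by apply/seteqP; split=> // _ [n _ <-]; case: (eD n) => [//|->].
split.
- move=> [[D [cD dD]] sD]; split.
    have [e De] := range_of _ cD dD; exists (fun n => baire_val (e n)).
    by split=> [n|]; [exact: baire_valP|apply/family_denseP; rewrite -De].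
  move=> T e eB eD z bz; pose e' t := baire_elt (eB t).
  have [||u [uD uz]] := sD (range e') _ _ (baire_elt bz).
  + exact: sub_countable (card_image_le _ _) (countableP _).
  + exact/family_denseP.
  have /choice[k kP] : forall n, exists t, e' t = u n.
    by move=> n; have [t _ <-] := uD n; exists t.
  exists k => x; have /baire_space_cvgP/(_ x) uzx := uz.
  rewrite (_ : (fun n => _) = (fun w => baire_val w x) \o u) //.
  by apply/funext => n; rewrite /= -kP.
- move=> [[e [eB eD]] eS]; split.
    exists (range (fun n => baire_elt (eB n))); split; last exact/family_denseP.
    exact: sub_countable (card_image_le _ _) (countableP _).
  move=> D cD dD z; have [e' De'] := range_of _ cD dD.
  have [|||k kP] := eS nat (fun n => baire_val (e' n)) _ _ (baire_val z).
  + by move=> n; exact: baire_valP.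
  + by apply/family_denseP; rewrite -De'.
  + exact: baire_valP.
  exists (e' \o k); split=> [n|]; first by rewrite De'; exists (k n).
  exact/baire_space_cvgP.
Qed.

End BaireSpace.

(** * Condensations onto spaces of countable weight *)

Lemma countType_enum (T : countType) (t0 : T) :
  exists r : nat -> T, forall t, exists n, r n = t.
Proof.
have [r [rT _]] := countable_enum t0 (countableP [set: T]).
by exists r => t; have [n _ <-] := rT t I; exists n.
Qed.

Section Separation.
Context (R : realType) (X : topologicalType).

Lemma tychonoff_separates (x y : X) : tychonoff_space X -> x <> y ->
  exists f : X -> R, [/\ continuous f, f x = 1 & f y = 0].
Proof.
move=> [crX hX] nxy.
have cy : closed [set x] by exact/accessible_closed_set1/hausdorff_accessible.
have /(crX y _ cy)/(@uniform_separatorP _ R)[f [cf _ fy fx]] : ~ [set x] y.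
  by move=> /= yx; apply: nxy.
exists f; split=> //; first by apply: fx; exists x.
by apply: fy; exists y.
Qed.

Definition separating (h : nat -> X -> R) :=
  (forall n, continuous (h n)) /\
  forall x y, (forall n, h n x = h n y) -> x = y.

(** A Baire function arises from countably many continuous functions by
    pointwise limits, and limits of equal sequences are equal: so the values of
    countably many continuous functions at a point determine its value. *)
Lemma baire_depends_countable (d : Order.disp_t) (W : orderType d)
    (W_wo : well_ordered W) (a : W) (f : X -> R) : baire a f ->
  exists g : nat -> X -> R, (forall n, continuous (g n)) /\
    forall x y, (forall n, g n x = g n y) -> f x = f y.
Proof.
elim/(wo_ind W_wo): a f => a IH f; case=> [{}f _ cf|{}f u a0 uB ucvg].
  by exists (fun=> f); split=> // x y /(_ 0%N).
have /choice[g gP] : forall n, exists g : nat -> X -> R,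
    (forall m, continuous (g m)) /\
    forall x y, (forall m, g m x = g m y) -> u n x = u n y.
  by move=> n; have [b ba bu] := uB n; exact: IH bu.
have [r rP] := @countType_enum (nat * nat)%type (0%N, 0%N).
exists (fun n => g (r n).1 (r n).2); split=> [n|x y gxy].
  exact: (gP _).1.
apply: (cvg_unique _ (ucvg x)) => //.
rewrite (_ : u ^~ x = u ^~ y); first exact: ucvg.
apply/funext => n.
by apply: (gP n).2 => m; have [k kE] := rP (n, m); have := gxy k; rewrite kE.
Qed.

End Separation.

Section Condensation.
Context (R : realType) (X : topologicalType).

(** The target is the set [X] with the initial topology of the countable family
    [h] and the map is the identity. This topology is induced by a uniformity,
    hence completely regular, it is Hausdorff because [h] separates points, and
    finitely many conditions [|h_n y - q| < 1/(m+1)] with [q] rational describe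
    a countable basis. *)
Lemma separating_condenses (h : nat -> X -> R) : separating h ->
  condenses_to_weight_le X nat.
Proof.
move=> [ch hsep].
pose phi (x : X) : {ptws nat -> R} := fun n => h n x.
pose Y := initial_topology phi.
have cvgY (F : set_system Y) (y : Y) : Filter F ->
    F --> y <-> forall n, h n @ F --> h n y.
  move=> FF; rewrite (cvg_initial phi y FF).
  exact: (@pointwise_cvgP nat R (phi @ F) (phi y)).
have cY n : continuous (h n : Y -> R).
  by move=> y; apply: (cvgY (nbhs y) y _).1.
exists Y, id; split.
- split; first exact: uniform_completely_regular.
  rewrite open_hausdorff => x y /eqP nxy.
  have [n nh] : exists n, h n x != h n y.
    by apply: contrapT => /forallNP hxy; apply: nxy; apply: hsep => n;
      apply/eqP; have /negP := hxy n; rewrite negbK.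
  have := @Rhausdorff R; rewrite open_hausdorff.
  move=> /(_ _ _ nh)[[A B] /= [Ax By] [oA oB AB0]].
  exists (h n @^-1` A, h n @^-1` B) => /=.
    by rewrite !inE in Ax By *.
  split; [by apply: open_comp => // z _; exact: cY|
          by apply: open_comp => // z _; exact: cY|].
  apply/eqP; rewrite -subset0 => z [Az Bz]; move/eqP: AB0.
  by rewrite -subset0 => /(_ (h n z)); apply.
- pose B (p : seq (nat * rat * nat)) : set Y :=
    [set y | forall c, c \in p -> `|h c.1.1 y - ratr c.1.2| < c.2.+1%:R^-1].
  exists (range B).
    exact: card_le_trans (card_image_le _ _) (countableP _).
  split=> [_ [p _ <-]|x].
    rewrite (_ : B p = \bigcap_(c in [set` p])
        (h c.1.1 @^-1` ball (ratr c.1.2 : R) c.2.+1%:R^-1)); last first.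
      by apply/seteqP; split=> y By c /= cp; have := By c cp;
        rewrite /ball/= distrC.
    rewrite bigcap_seq; elim/big_ind: _ => [|U V oU oV|c _].
    - exact: openT.
    - exact: openI.
    by apply: open_comp => [z _|]; [exact: cY|exact: ball_open].
  (* That the basic sets form a basis means that the filter [F] which they
     generate at [x] converges to [x]; it suffices to test this on each
     [h n]. *)
  set F := filter_from _ _.
  have FF : Filter F.
    apply: filter_from_filter.
      by exists (B [::]); split; [exists [::]|move=> c].
    move=> _ _ [[p _ <-] px] [[q _ <-] qx]; exists (B (p ++ q)).
      split; first by exists (p ++ q).
      by move=> c; rewrite mem_cat => /orP[]; [exact: px|exact: qx].
    by move=> y By; split=> c cp; apply: By; rewrite mem_cat cp ?orbT.
  apply/cvgY => n; apply/cvgrPdist_lt => eps eps0.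
  have [m [v vE [v0 veps]]] :
      exists m, exists2 v : R, v = m.+1%:R^-1 & 0 < v /\ v < eps / 2.
    have eps20 : 0 < eps / 2 by rewrite divr_gt0.
    have [m _ /(_ m (leqnn m)) meps] := natS_inv_lt eps20.
    by exists m, m.+1%:R^-1 => //; rewrite invr_gt0.
  have [q] : exists q : rat, ratr q \in `](h n x - v), (h n x + v)[.
    by apply: rat_in_itvoo; lra.
  rewrite in_itv/= => /andP[q1 q2].
  exists (B [:: (n, q, m)]).
    split; first by exists [:: (n, q, m)].
    move=> c; rewrite inE => /eqP-> /=; rewrite -vE ltr_norml.
    by apply/andP; split; lra.
  move=> y /(_ (n, q, m)); rewrite mem_head => /(_ isT)/=.
  by rewrite -vE !ltr_norml => /andP[? ?]; apply/andP; split; lra.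
- by apply: continuous_comp_initial => x; apply/pointwise_cvgP => n; exact: ch.
- by [].
- by rewrite image_id.
Qed.

Lemma separating_iw (h : nat -> X -> R) : separating h -> iw_is X nat.
Proof.
move=> sh; split; first exact: infinite_nat; last by move=> K' /infiniteP.
exact: separating_condenses sh.
Qed.

(** Complete regularity gives a separating function for each pair of points;
    countably many functions suffice if each is made constant near the two points, because then a
    pair of basic open sets already determines which functions are acceptable
    and one of them can be chosen per pair. If [g] separates the two points,
    [clamp (3 * g - 1)] is 1 where [g > 2/3] and 0 where [g < 1/3]. *)
Lemma condenses_separating01 : condenses_to_weight_le X nat ->
  exists2 th : nat -> X -> R, (forall n, continuous (th n)) &
    forall x y, x <> y -> exists n, th n x = 1 /\ th n y = 0.
Proof.
move=> [Y [f [tY [B cB [oB bB]] cf fI _]]].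
have [b [Bb _]] := countable_enum setT cB.
pose good U V (th : Y -> R) :=
  [/\ continuous th, forall y, U y -> th y = 1 & forall y, V y -> th y = 0].
have /choice[th thP] : forall p : nat * nat, exists th : Y -> R,
    continuous th /\
    ((exists th', good (b p.1) (b p.2) th') -> good (b p.1) (b p.2) th).
  move=> p; have [[th' gth']|nth] :=
    pselect (exists th', good (b p.1) (b p.2) th').
    by exists th'; split=> //; case: gth'.
  by exists (fun=> 0); split=> // y; exact: cvg_cst.
have [r rP] := @countType_enum (nat * nat)%type (0%N, 0%N).
exists (fun n => th (r n) \o f) => [n x|x y nxy].
  by apply: continuous_comp; [exact: cf|exact: (thP _).1].
have [|g [cg gx gy]] := @tychonoff_separates R Y (f x) (f y) tY.
  by move=> /fI.
have basic (y' : Y) (O : set Y) : open O -> O y' ->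
    exists2 n, b n y' & b n `<=` O.
  move=> oO Oy; have [V [BV Vy] VO] := bB y' O (open_nbhs_nbhs (conj oO Oy)).
  by have [n _ bn] := Bb V BV; exists n; rewrite bn.
have [||m bm mg] := basic (f x) (g @^-1` [set t | t > 2/3]).
- by apply: open_comp => [? _|]; [exact: cg|exact: open_gt].
- by rewrite /= gx; lra.
have [||n bn ng] := basic (f y) (g @^-1` [set t | t < 1/3]).
- by apply: open_comp => [? _|]; [exact: cg|exact: open_lt].
- by rewrite /= gy; lra.
have [k rk] := rP (m, n); exists k => /=; rewrite rk.
have [|_ th1 th0] := (thP (m, n)).2.
  exists (fun y => clamp (3 * g y - 1)); split=> [z|z /mg/= gz|z /ng/= gz].
  - apply: (@continuous_comp _ _ _ (fun z => 3 * g z - 1)); last first.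
      exact: clamp_continuous.
    by apply: cvgB; [apply: cvgM; [exact: cvg_cst|exact: cg]|exact: cvg_cst].
  - by apply: clamp_ge1; lra.
  - by apply: clamp_le0; lra.
by split; [exact: th1|exact: th0].
Qed.

End Condensation.

(** * Covers and the selection principle *)

Lemma finite_nat_bounded (A : set nat) : finite_set A ->
  exists N, forall n, A n -> (n < N)%N.
Proof.
move=> /finite_seqP[s ->]; exists (\max_(i <- s) i).+1 => n ns.
by rewrite ltnS; exact: leq_bigmax_seq.
Qed.

Lemma near_forall_mem (I : Type) (F : set_system I) (FF : Filter F)
    (T : eqType) (P : T -> I -> Prop) (s : seq T) :
  (forall x, x \in s -> \forall n \near F, P x n) ->
  \forall n \near F, forall x, x \in s -> P x n.
Proof.
elim: s => [_|y s IH sP]; first by near=> n => x.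
have Py := sP y (mem_head _ _).
have Ps : \forall n \near F, forall x, x \in s -> P x n.
  by apply: IH => x xs; apply: sP; rewrite inE xs orbT.
near=> n => x; rewrite inE => /predU1P[->|]; first by near: n.
by move: x; near: n.
Unshelve. all: by end_near. Qed.

Section Covers.
Context (X : Type).
Implicit Types (Z : set (set X)).

(** The range is infinite because a set equal to [b n] for infinitely many [n]
    contains every point, hence is the whole space. *)
Lemma gamma_cover_range (b : nat -> set X) : (forall n, b n <> setT) ->
  (forall x, \forall n \near \oo, b n x) -> gamma_cover (range b).
Proof.
move=> bT bx; split.
- apply/seteqP; split=> // x _; have [n bnx] := filter_ex (bx x).
  by exists (b n) => //; exists n.
- move=> /finite_seqP[s sE].
  have : \forall n \near \oo, forall A, A \in s -> b n <> A.
    apply: near_forall_mem => A As.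
    have [k _ bkA] : range b A by rewrite sE.
    have /existsNP[x nAx] : ~ forall x, A x.
      by move=> AT; apply: (bT k); rewrite bkA; apply/seteqP; split.
    near=> n => bnA; apply: nAx; rewrite -bnA; near: n.
    exact: bx.
  move=> /filter_ex[n bns]; apply: (bns (b n)) => //.
  have : range b (b n) by exists n.
  by rewrite sE.
- move=> x; have [N _ bN] := bx x.
  apply: (@sub_finite_set _ _ (b @` `I_N)); last exact/finite_image/finite_II.
  move=> _ [[n _ <-] nbx]; exists n => //=; rewrite ltnNge; apply/negP => Nn.
  by apply: nbx; exact: bN.
Unshelve. all: by end_near. Qed.

Lemma omega_cover_neq_setT (U : set (set X)) (A : set X) :
  omega_cover U -> U A -> A <> setT.
Proof. by move=> [_ UT _] UA AT; apply: UT; rewrite -AT. Qed.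

Lemma omega_cover_infinite (U : set (set X)) :
  omega_cover U -> infinite_set [set: X].
Proof.
move=> [_ UT UF] finX; have [A UA XA] := UF _ finX.
by apply: UT; rewrite (_ : [set: X] = A)//; apply/seteqP; split.
Qed.

Lemma countable_omega_cover_enum (U : set (set X)) : countable U ->
  omega_cover U -> exists e : nat -> set X, U = range e.
Proof.
move=> cU [_ _ UF]; have [A0 UA0 _] := UF _ (finite_set0 X).
have [e [Ue eU]] := countable_enum A0 cU; exists e.
by apply/seteqP; split=> // _ [n _ <-]; case: (eU n) => [//|->].
Qed.

End Covers.

(** Let [U n] be the given omega-covers, enumerated by [e n]. The sets
    [B (n, s)], which intersect one member of each [U i] with [i <= n] and the
    set [C n], form an omega-cover, so that it contains a gamma-cover [V]. Since
    [C n] misses a point, which only finitely many members of [V] miss, only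
    finitely many members of [V] come from level [n]; hence [V] has members of
    arbitrarily high level. One of level at least [m] lies inside a member of
    [U m], which is the set to select.
    In the usual proof for open covers, [C n] is the complement of a point; such
    complements need not be in [Z^a], so [C] is left as a parameter. *)
Lemma S1_of_cover_gamma_set (X : choiceType) (Z : set (set X))
    (C : nat -> set X) :
  (forall F : nat -> set X, (forall n, Z (F n)) -> Z (\bigcap_n F n)) ->
  (forall n, Z (C n)) -> (forall n, C n <> setT) ->
  (forall x, \forall n \near \oo, C n x) ->
  cover_gamma_set Z -> S1 (countable_omega_covers Z) (countable_gamma_covers Z).
Proof.
move=> ZI ZC CT Cx gZ U UO.
have /choice[e eE] : forall n, exists e : nat -> set X, U n = range e.
  by move=> n; have [cU _ oU] := UO n; exact: countable_omega_cover_enum.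
have Ue n k : U n (e n k) by rewrite eE; exists k.
have /choice[y yC] : forall n, exists y, ~ C n y.
  move=> n; apply/existsNP => Cn; apply: (CT n).
  by apply/seteqP; split.
(* From index [n + 1] on the factor is [C n], which makes [B] a countable
   intersection. *)
pose B (p : nat * seq nat) :=
  \bigcap_i (if (i <= p.1)%N then e i (nth 0%N p.2 i) else C p.1).
have Be p m : (m <= p.1)%N -> B p `<=` e m (nth 0%N p.2 m).
  by move=> mp x /(_ m I); rewrite mp.
have BC p : B p `<=` C p.1 by move=> x /(_ p.1.+1 I); rewrite ltnn.
have BF (F : set X) : finite_set F -> exists p, F `<=` B p.
  move=> finF; have [s sF] := (finite_seqP F).1 finF.
  have /filter_ex[n nC] : \forall n \near \oo, forall x, x \in s -> C n x.
    by apply: near_forall_mem => x _; exact: Cx.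
  have /choice[k kF] : forall i, exists k, F `<=` e i k.
    move=> i; have [_ _ [_ _ /(_ F finF)[A UA FA]]] := UO i.
    by move: UA; rewrite eE => -[k _ kA]; exists k; rewrite kA.
  exists (n, mkseq k n.+1) => // x Fx i _ /=; case: ifP => [lein|_].
    by rewrite nth_mkseq//; exact: kF.
  by apply: nC; move: Fx; rewrite sF.
have [|V VB [_ Vinf Vx]] := gZ (range B).
  split.
  - exact: card_le_trans (card_image_le _ _) (countableP _).
  - move=> _ [p _ <-]; apply: ZI => i; case: ifP => _; last exact: ZC.
    by have [_ UZ _] := UO i; exact: UZ.
  - split.
    + apply/seteqP; split=> // x _; have [p xp] := BF [set x] (finite_set1 x).
      by exists (B p); [exists p|exact: xp].
    + move=> [p _ BT]; apply: (yC p.1); apply: BC; by rewrite BT.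
    + by move=> F /BF[p Fp]; exists (B p) => //; exists p.
(* The same set may be [B p] for several [p]: fixing one level per set keeps
   the levels of finitely many sets bounded. *)
have /choice[lev levE] : forall A, exists p, V A -> B p = A.
  move=> A; have [/VB[p _ pA]|nVA] := pselect (V A); first by exists p.
  by exists (0%N, [::]).
have /choice[A AP] : forall m, exists A, V A /\ (m <= (lev A).1)%N.
  move=> m; apply: contrapT => /forallNP Vm; apply: Vinf.
  apply: (@sub_finite_set _ _ (\bigcup_(n in `I_m) [set A | V A /\ ~ A (y n)])).
    move=> A VA; exists (lev A).1 => /=.
      by rewrite ltnNge; apply/negP => mA; apply: (Vm A).
    split=> // Ay; apply: (yC (lev A).1); apply: BC.
    by rewrite levE.
  by apply: bigcup_finite => // n _; exact: Vx.
exists (fun m => e m (nth 0%N (lev (A m)).2 m)); split; first by move=> n.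
split.
- exact: card_le_trans (card_image_le _ _) (countableP _).
- move=> _ [m _ <-]; have [_ UZ _] := UO m; exact: UZ.
- apply: gamma_cover_range => [m|x].
    have [_ _ oU] := UO m; exact: omega_cover_neq_setT oU (Ue _ _).
  have [N NP] := finite_nat_bounded (finite_image (fun A => (lev A).1) (Vx x)).
  exists N => // m /= Nm; have [VA mA] := AP m.
  apply: (Be _ _ mA); rewrite levE//; apply: contrapT => nAx.
  have := NP (lev (A m)).1; rewrite ltnNge (leq_trans Nm mA).
  case/(_ _)/negP => //.
  by exists (A m).
Qed.

(** * A countable dense family of continuous functions *)

Section RationalAlgebra.
Context (R : realType) (X : topologicalType) (th : nat -> X -> R).

Definition rat_comb (p : seq (rat * seq nat)) (x : X) : R :=
  \sum_(c <- p) ratr c.1 * \prod_(k <- c.2) th k x.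

Lemma rat_comb_continuous p : (forall n, continuous (th n)) ->
  continuous (rat_comb p).
Proof.
move=> cth.
have cprod (q : seq nat) : continuous (fun x => \prod_(k <- q) th k x).
  elim: q => [|k q IH].
    rewrite (_ : (fun x => _) = fun=> 1); first by move=> x; exact: cvg_cst.
    by apply/funext => x; rewrite big_nil.
  rewrite (_ : (fun x => _) = fun x => th k x * \prod_(k <- q) th k x).
    by move=> x; apply: cvgM; [exact: cth|exact: IH].
  by apply/funext => x; rewrite big_cons.
elim: p => [|c p IH].
  rewrite (_ : rat_comb _ = fun=> 0); first by move=> x; exact: cvg_cst.
  by apply/funext => x; rewrite /rat_comb big_nil.
rewrite (_ : rat_comb _ = fun x =>
    ratr c.1 * \prod_(k <- c.2) th k x + rat_comb p x).
  move=> x; apply: cvgD; last exact: IH.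
  by apply: cvgM; [exact: cvg_cst|exact: cprod].
by apply/funext => x; rewrite /rat_comb big_cons.
Qed.

(** As in Lagrange interpolation, the product over the other points [y] of [s]
    of functions that are 1 at [x] and 0 at [y] is, on [s], the indicator of
    [x]; it remains to replace the prescribed values by rational ones. *)
Lemma rat_comb_dense :
  (forall x y, x <> y -> exists n, th n x = 1 /\ th n y = 0) ->
  forall (z : X -> R) (s : seq X) (eps : R), 0 < eps ->
  exists p, forall x, x \in s -> `|rat_comb p x - z x| < eps.
Proof.
move=> thP z s eps eps0.
have /choice[k kP] : forall xy : X * X, exists n,
    xy.1 <> xy.2 -> th n xy.1 = 1 /\ th n xy.2 = 0.
  move=> [x y]; have [->|/thP[n ?]] := pselect (x = y); last by exists n.
  by exists 0%N.
have /choice[q qP] : forall x, exists q : rat, `|ratr q - z x| < eps.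
  move=> x; have [|q] := @rat_in_itvoo R (z x - eps) (z x + eps); first by lra.
  by rewrite in_itv/= => qz; exists q; rewrite ltr_distl.
pose p := [seq (q x, [seq k (x, y) | y <- undup s & y != x]) | x <- undup s].
exists p => x xs; suff -> : rat_comb p x = ratr (q x) by exact: qP.
rewrite /rat_comb big_map (bigD1_seq x) ?mem_undup ?undup_uniq//=.
rewrite [X in _ + X]big1 ?addr0 => [|y yx].
  rewrite big_map big_filter big1 ?mulr1// => y yx.
  by have [|->] := kP (x, y); first by apply/eqP; rewrite eq_sym.
rewrite /= big_map (bigD1_seq x) ?filter_uniq ?undup_uniq//=; last first.
  by rewrite mem_filter mem_undup xs eq_sym yx.
rewrite (_ : th _ x = 0) ?mul0r ?mulr0//.
by have [|_ ->] := kP (y, x); first exact/eqP.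
Qed.

End RationalAlgebra.

(** * Disjoint cozero sets in an infinite space *)

Section DisjointCozero.
Context (R : realType) (X : topologicalType).

(** One step in the construction of disjoint cozero sets: [og.1] gives the next
    set of the sequence, and [og.2] what remains to be split; this is why its
    cozero set has to be infinite. *)
Definition cozero_split (g : X -> R) (og : (X -> R) * (X -> R)) :=
  [/\ continuous og.1 /\ continuous og.2,
      (exists x, 0 < og.1 x) /\ infinite_set [set x | 0 < og.2 x],
      forall x, 0 < og.1 x -> 0 < g x,
      forall x, 0 < og.2 x -> 0 < g x &
      forall x, 0 < og.1 x -> ~ 0 < og.2 x].

(** Let [f] be 1 at [x] and 0 at [y], both in the cozero set. The sets
    [f < 2/3] and [f > 1/3] cover the space, so one of them meets the cozero set
    in an infinite set; [x], respectively [y], lies in the part beyond the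
    same threshold. *)
Lemma infinite_split (g : X -> R) : tychonoff_space X -> continuous g ->
    infinite_set [set x | 0 < g x] -> exists og, cozero_split g og.
Proof.
move=> tX cg ginf.
have [x [y [gx gy nxy]]] : exists x y, [/\ 0 < g x, 0 < g y & x <> y].
  have [x gx] := infinite_setN0 ginf.
  have [y [gy nyx]] : [set x | 0 < g x] `\ x !=set0.
    by apply: infinite_setN0; apply: infinite_setD => //; exact: finite_set1.
  by exists x, y; split=> // xy; apply: nyx.
have [f [cf fx fy]] := tychonoff_separates R tX nxy.
pose lo x := Num.min (g x) (2/3 - f x).
pose lo' x := Num.min (g x) (f x - 2/3).
pose hi x := Num.min (g x) (f x - 1/3).
pose hi' x := Num.min (g x) (1/3 - f x).
have cmin (u : X -> R) : continuous u ->
    continuous (fun x => Num.min (g x) (u x)).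
  by move=> cu z; exact: (@continuous_min R X g u z (cg z) (cu z)).
have c1 c : continuous (fun x => f x - c).
  by move=> z; apply: cvgB; [exact: cf|exact: cvg_cst].
have c2 c : continuous (fun x => c - f x).
  by move=> z; apply: cvgB; [exact: cvg_cst|exact: cf].
have [loinf|lofin] := pselect (infinite_set [set x | 0 < lo x]).
  exists (lo', lo); split=> //=.
  - by split; apply: cmin.
  - by split=> //; exists x; rewrite lt_min gx fx; lra.
  - by move=> z; rewrite lt_min => /andP[].
  - by move=> z; rewrite lt_min => /andP[].
  - by move=> z; rewrite !lt_min => /andP[_ ?] /andP[_ ?]; lra.
exists (hi', hi); split=> //=.
- by split; apply: cmin.
- split; first by exists y; rewrite lt_min gy fy; lra.
  move=> hifin; apply: ginf.
  apply: (@sub_finite_set _ _ ([set x | 0 < lo x] `|` [set x | 0 < hi x])).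
    move=> z /= gz; rewrite /lo /hi !lt_min gz/=.
    by have [fz|fz] := lerP (f z) (1/3); [left|right]; lra.
  by rewrite finite_setU; split=> //; exact: contrapT.
- by move=> z; rewrite lt_min => /andP[].
- by move=> z; rewrite lt_min => /andP[].
- by move=> z; rewrite !lt_min => /andP[_ ?] /andP[_ ?]; lra.
Qed.

(** The complements of these cozero sets are proper zero sets and every point
    lies in all but at most one of them: they are the sets [C n] required by
    [S1_of_cover_gamma_set]. *)
Lemma disjoint_cozero : tychonoff_space X -> infinite_set [set: X] ->
  exists o : nat -> X -> R, [/\ forall n, continuous (o n),
    forall n, exists x, 0 < o n x &
    forall m n x, 0 < o m x -> 0 < o n x -> m = n].
Proof.
move=> tX Xinf.
pose good (g : X -> R) := continuous g /\ infinite_set [set x | 0 < g x].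
have /choice[next nextP] : forall g, exists og, good g -> cozero_split g og.
  move=> g; have [[cg ginf]|ng] := pselect (good g); last by exists (g, g).
  by have [og ?] := infinite_split tX cg ginf; exists og.
pose G n := iter n (fun g => (next g).2) (fun=> 1).
have Ggood n : good (G n).
  elim: n => [|n /nextP[[_ c2] [_ i2] _ _ _]]; last by split.
  split; first by move=> x; exact: cvg_cst.
  suff -> : [set x | 0 < G 0%N x] = setT by [].
  by apply/seteqP; split=> // x _; exact: ltr01.
have GP n : cozero_split (G n) (next (G n)) by exact: nextP.
have Gdecr m n x : (m <= n)%N -> 0 < G n x -> 0 < G m x.
  elim: n => [|n IH]; first by rewrite leqn0 => /eqP->.
  rewrite leq_eqVlt => /predU1P[->//|]; rewrite ltnS => mn Gx; apply: (IH mn).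
  by have [_ _ _ G2 _] := GP n; exact: G2.
have disj m n x : (m < n)%N -> 0 < (next (G m)).1 x -> ~ 0 < (next (G n)).1 x.
  move=> mn o1 o2; have [_ _ _ _ mD] := GP m; apply: (mD x o1).
  by apply: (Gdecr _ _ _ mn); have [_ _ G1 _ _] := GP n; exact: G1.
exists (fun n => (next (G n)).1); split.
- by move=> n; have [[]] := GP n.
- by move=> n; have [_ []] := GP n.
- move=> m n x om on; have [mn|nm|//] := ltngtP m n.
  + by case: (disj m n x mn om on).
  + by case: (disj n m x nm on om).
Qed.

End DisjointCozero.

(** * The implications *)

Section Implications.
Context (R : realType) (X : topologicalType).
Context (d : Order.disp_t) (W : orderType d) (W_wo : well_ordered W).
Context (a : W) (a_gt0 : ~ is_ord0 a).
Local Notation BX := (baire_space R X a).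
Local Notation Z := (Zset R X a).

(** A dense family separates points, and each of its members depends on
    countably many continuous functions only. *)
Lemma strongly_sequentially_separable_iw : tychonoff_space X ->
  strongly_sequentially_separable BX ->
  iw_is X nat.
Proof.
move=> tX /(strongly_sequentially_separableP R X W_wo a)[[e [eB eD]] _].
have /choice[g gP] := fun n => baire_depends_countable W_wo (eB n).
have [r rP] := @countType_enum (nat * nat)%type (0%N, 0%N).
apply: (@separating_iw R X (fun n => g (r n).1 (r n).2)).
split=> [n|x y gxy]; first exact: (gP _).1.
have exy n : e n x = e n y.
  by apply: (gP n).2 => m; have [k kE] := rP (n, m); have := gxy k; rewrite kE.
apply: contrapT => nxy; have [f [cf fx fy]] := tychonoff_separates R tX nxy.
have [|n nP] := eD f (baire_of_continuous W_wo a cf) [:: x; y] (1/2).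
  by lra.
have := nP x (mem_head _ _); have := nP y; rewrite !inE eqxx orbT => /(_ isT).
rewrite exy fx fy !ltr_norml => /andP[? ?] /andP[? ?]; clear nxy; lra.
Qed.

(** Given an omega-cover [A 0, A 1, ...] and a dense family [e], the functions
    equal to [e n] on [A m] and to 1 elsewhere are again dense, since every
    finite set lies in some [A m]. A sequence of them that tends to 0 is
    eventually different from 1 at each point, so the sets [A m] along it form a
    gamma-cover. *)
Lemma strongly_sequentially_separable_cover_gamma_set :
  strongly_sequentially_separable BX ->
  cover_gamma_set Z.
Proof.
move=> /(strongly_sequentially_separableP R X W_wo a)[[e [eB eD]] eS].
move=> U [cU UZ oU].
have [A UA] := countable_omega_cover_enum cU oU.
have UAn n : U (A n) by rewrite UA; exists n.
pose E (p : nat * nat) x := if x \in A p.2 then e p.1 x else 1.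
have EB p : baire a (E p).
  apply: (baire_glue W_wo a_gt0 (UZ _ (UAn p.2)) (eB p.1)).
  exact: baire_cst.
have ED : family_dense a E.
  move=> z bz s eps eps0; have [n ne] := eD z bz s eps eps0.
  have [_ _ /(_ [set` s] (finite_seq s))[B + sB]] := oU.
  rewrite UA => -[m _ AmB]; exists (n, m) => x xs.
  by rewrite /E mem_set ?AmB; [exact: ne|exact: sB].
have [k k0] := eS _ E EB ED (fun=> 0) (baire_cst X W_wo a 0).
exists (range (fun n => A (k n).2)); first by move=> _ [n _ <-].
apply: gamma_cover_range => [n|x].
  exact: omega_cover_neq_setT oU (UAn _).
have /cvgrPdist_lt/(_ 1 ltr01) := k0 x; apply: filterS => n.
by rewrite /E; case: ifPn => [/set_mem//|_]; rewrite sub0r normrN normr1 ltxx.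
Qed.

Lemma cover_gamma_set_S1 : tychonoff_space X -> cover_gamma_set Z ->
  S1 (countable_omega_covers Z) (countable_gamma_covers Z).
Proof.
move=> tX gZ U UO.
have Xinf : infinite_set [set: X].
  by have [_ _ oU] := UO 0%N; exact: omega_cover_infinite oU.
have [g [cg g_ex g_disj]] := disjoint_cozero R tX Xinf.
have [b ba] := (not_is_ord0P a).1 a_gt0.
apply: (@S1_of_cover_gamma_set X Z (fun n => [set x | g n x <= 0])) => //.
- exact: Zset_bigcap.
- move=> n; apply: (Zset_le W_wo _ ba); exact: baire_of_continuous.
- move=> n gT; have [x] := g_ex n; have : [set x | g n x <= 0] x by rewrite gT.
  by rewrite /= leNgt => /negP.
- move=> x; have [[m gm]|no] := pselect (exists m, 0 < g m x).
    near=> n; rewrite /= leNgt; apply/negP => gn.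
    have mn : (m < n)%N by near: n; exact: nbhs_infty_gt.
    by move: mn; rewrite (g_disj _ _ _ gm gn) ltnn.
  by near=> n; rewrite /= leNgt; apply/negP => gn; apply: no; exists n.
Unshelve. all: by end_near. Qed.

Lemma iw_separable : iw_is X nat ->
  exists e : nat -> X -> R, (forall n, baire a (e n)) /\ family_dense a e.
Proof.
move=> [_ /(@condenses_separating01 R)[th cth thP] _].
have [r rP] := @countType_enum (seq (rat * seq nat)) [::].
exists (fun n => rat_comb th (r n)); split=> [n|z _ s eps eps0].
  exact/(baire_of_continuous W_wo)/rat_comb_continuous.
have [p pP] := rat_comb_dense thP z s eps0.
by have [n np] := rP p; exists n; rewrite np.
Qed.

(** The set where [|f| < eps] is in general not in [Z^a] but is covered by an
    increasing sequence of sets of [Z^a] on which [|f| <= eps]: if [f] is the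
    limit of [u], take the points where [|u_k| <= eps] for all [k >= j]. *)
Lemma baire_sublevel (f : X -> R) (eps : R) : baire a f -> 0 < eps ->
  exists F : nat -> set X, [/\ forall j, Z (F j),
    forall j x, F j x -> `|f x| <= eps &
    forall (s : seq X), (forall x, x \in s -> `|f x| < eps) ->
      exists j, forall x, x \in s -> F j x].
Proof.
move=> /(baire_seq a_gt0)[u [uB ucvg]] eps0.
have cvg_norm x : `|u n x| @[n --> \oo] --> `|f x| by exact: cvg_norm.
exists (fun j => \bigcap_k [set x | `|u (k + j)%N x| <= eps]); split.
- move=> j; apply: Zset_bigcap => k; have [b ba bu] := uB (k + j)%N.
  by apply: (Zset_le W_wo _ ba); exact: baire_norm.
- move=> j x Fx; rewrite leNgt; apply/negP => epsf.
  have /filter_ex[n] : \forall n \near \oo, eps < `|u n x| /\ (j <= n)%N.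
    apply: filterI; last exact: nbhs_infty_ge.
    exact: (cvgr_gt _ (cvg_norm x)).
  by move=> [+ /subnK jn]; have := Fx (n - j)%N I; rewrite /= jn leNgt => /negP.
- move=> s sf; have [N _ NP] : \forall n \near \oo, forall x, x \in s ->
      `|u n x| <= eps.
    apply: near_forall_mem => x /sf fx.
    by apply: (filterS _ (cvgr_lt _ (cvg_norm x) _ fx)) => n /ltW.
  by exists N => x xs k _; apply: NP => //=; exact: leq_addl.
Qed.

(** To approximate [z] from a dense family [e], apply [baire_sublevel] to every
    [e t - z] and [eps = 1/(n+1)]. For fixed [n] the sets so obtained catch all
    finite sets, by density; if none of them is the whole space they form an
    omega-cover. Selecting one set for each [n] selects a sequence of indices
    [t], whose functions converge to [z] along a subsequence on which the
    selected sets are distinct. *)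
Lemma S1_strongly_sequentially_separable : iw_is X nat ->
  S1 (countable_omega_covers Z) (countable_gamma_covers Z) ->
  strongly_sequentially_separable BX.
Proof.
move=> iwX S; apply/(strongly_sequentially_separableP R X W_wo a); split.
  exact: iw_separable.
move=> T e eB eD z bz.
pose eps n : R := n.+1%:R^-1.
have eps0 n : 0 < eps n by rewrite invr_gt0.
have /choice[F FP] : forall tn : T * nat, exists F : nat -> set X,
    [/\ forall j, Z (F j), forall j x, F j x -> `|e tn.1 x - z x| <= eps tn.2 &
     forall (s : seq X), (forall x, x \in s -> `|e tn.1 x - z x| < eps tn.2) ->
      exists j, forall x, x \in s -> F j x].
  move=> [t n]; exact: baire_sublevel (baireB W_wo (eB t) bz) (eps0 n).
pose U n := [set A | exists t j, A = F (t, n) j].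
have cU n : countable (U n).
  apply: (@sub_countable _ _ _ (range (fun tj : T * nat => F (tj.1, n) tj.2))).
    by apply: subset_card_le => _ [t [j ->]]; exists (t, j).
  exact: card_le_trans (card_image_le _ _) (countableP _).
have UF n (s : seq X) : exists2 A, U n A & [set` s] `<=` A.
  have [t te] := eD z bz s (eps n) (eps0 n).
  have [_ _ /(_ s te)[j jF]] := FP (t, n).
  by exists (F (t, n) j) => //; exists t, j.
(* A sequence with error at most [eps (n k)] eventually at each point, with
   [n k] tending to infinity, converges to [z]. *)
have finish (t : nat -> T) (n : nat -> nat) :
    (forall N, \forall k \near \oo, (N <= n k)%N) ->
    (forall x, \forall k \near \oo, `|e (t k) x - z x| <= eps (n k)) ->
    exists k : nat -> T, forall x, e (k n) x @[n --> \oo] --> z x.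
  move=> ny tz; exists t => x; apply/cvgrPdist_lt => r r0.
  have [N _ NP] := natS_inv_lt r0.
  near=> k; rewrite distrC; apply: (@le_lt_trans _ _ (eps (n k))).
    by near: k; exact: tz.
  by apply: NP => /=; near: k; exact: ny.
(* If the whole space is obtained for arbitrarily large [n], there is uniform
   convergence; otherwise it no longer occurs from some [N] on. *)
have [UT|/existsNP[N UNT]] :=
    pselect (forall N, exists n, (N <= n)%N /\ U n setT).
  have /choice[n nP] := UT.
  have /choice[t tP] : forall k, exists t, exists j, setT = F (t, n k) j.
    by move=> k; have [_ [t [j]]] := nP k; exists t, j.
  apply: (finish t n) => [N|x].
    by near=> k; apply: leq_trans (nP k).1; near: k; exact: nbhs_infty_ge.
  near=> k; have [j tj] := tP k; have [_ + _] := FP (t k, n k).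
  by move=> /(_ j x); rewrite -tj; exact.
have UO n : countable_omega_covers Z (U (N + n)%N).
  split; first exact: cU.
  - by move=> _ [t [j ->]]; have [] := FP (t, (N + n)%N).
  - split.
    + apply/seteqP; split=> // x _; have [A UA xA] := UF (N + n)%N [:: x].
      by exists A => //; apply: xA => /=; rewrite mem_head.
    + by move=> UnT; apply: UNT; exists (N + n)%N; rewrite leq_addr.
    + by move=> G /finite_seqP[s ->]; exact: UF.
have [b [bU [_ _ [_ binf bx]]]] := S _ UO.
have /choice[t tP] : forall n, exists t, exists j, b n = F (t, (N + n)%N) j.
  by move=> n; have [t [j]] := bU n; exists t, j.
(* A gamma-cover is a set of sets, so that a set missing a point may be selected
   infinitely often; an injective enumeration [g] of it avoids this. *)
have /infiniteP/ppcard_leP[g] := binf.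
have /choice[m mg] : forall k, exists m, b m = g k.
  move=> k; have [m _ bm] : range b (g k) by exact: funS.
  by exists m.
have g_inj : injective g by move=> i j; apply: inj; rewrite inE.
have m_inj : injective m by move=> i j mij; apply: g_inj; rewrite -!mg mij.
have near_out (V : Type) (h : nat -> V) (A : set V) : injective h ->
    finite_set A -> \forall k \near \oo, ~ A (h k).
  move=> h_inj finA.
  have [K KP] : exists K, forall k, A (h k) -> (k < K)%N.
    apply: finite_nat_bounded; apply: finite_preimage => //.
    by move=> i j _ _; exact: h_inj.
  by exists K => // k /= Kk /KP; rewrite ltnNge Kk.
apply: (finish (t \o m) (fun k => N + m k)%N) => [M|x].
  apply: filterS (near_out _ m `I_M m_inj (finite_II M)) => k /= /negP.
  by rewrite -leqNgt => /leq_trans; apply; exact: leq_addl.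
apply: filterS (near_out _ g _ g_inj (bx x)) => k /= gkx.
have [_ + _] := FP (t (m k), (N + m k)%N); have [j bj] := tP (m k).
move=> /(_ j x); rewrite -bj; apply; apply: contrapT => nbx.
by apply: gkx; rewrite -mg; split=> //; exists (m k).
Unshelve. all: by end_near. Qed.

End Implications.

Theorem theorem4p19 (R : realType) (X : topologicalType)
  (d : Order.disp_t) (W : orderType d) (omega1 alpha : W)
  (X_tychonoff : tychonoff_space X)
  (W_wo : well_ordered W)
  (omega1P : is_omega1 omega1)
  (alpha_gt0 : ~ is_ord0 alpha)
  (alpha_le : (alpha <= omega1)%O) :
  (strongly_sequentially_separable (baire_space R X alpha) <->
   iw_is X nat /\
   S1 (countable_omega_covers (Zset R X alpha))
      (countable_gamma_covers (Zset R X alpha))) /\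
  (strongly_sequentially_separable (baire_space R X alpha) <->
   iw_is X nat /\ cover_gamma_set (Zset R X alpha)).
Proof.
have to3 : strongly_sequentially_separable (baire_space R X alpha) ->
    iw_is X nat /\ cover_gamma_set (Zset R X alpha).
  move=> sss; split; first exact: strongly_sequentially_separable_iw sss.
  exact: strongly_sequentially_separable_cover_gamma_set.
split; split.
- by move=> /to3[iwX gX]; split=> //; exact: cover_gamma_set_S1.
- by move=> [iwX hX]; exact: S1_strongly_sequentially_separable.
- exact: to3.
- move=> [iwX gX]; apply: S1_strongly_sequentially_separable => //.
  exact: cover_gamma_set_S1.
Qed.
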